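(* Let $E, F$ be Riesz spaces and $T \in \mathcal{O}(E,F)$. If for every $x \in E$ the infimum $-R(x) := \inf \{T(u): \, u \sqsubseteq x\}$ exists in $F$, then $T^-$ exists in $\mathcal{O}(E,F)$ and $T^- = R$. Moreover, in the case of existence (of the infima $-R(x)$ for all $x\in E$) the following hold. (1) If $T \in \mathcal{P}(E,F)$ then $T^- \in \mathcal{P}(E,F)$. (2) If $T \in \mathcal{U}(E,F)$ then $T^- \in \mathcal{U}(E,F)$.
   Context: A Riesz space is a real vector lattice (no Dedekind completeness or Archimedean property is assumed); $x \perp y$ (disjointness) means $|x| \wedge |y| = 0$. An element $x$ is a fragment of $y$, written $x \sqsubseteq y$, if $x \perp y - x$; $\mathfrak{F}_e$ is the set of all fragments of $e$. A function $T \colon E \to F$ is an orthogonally additive operator (OAO) if $T(x+y) = T(x) + T(y)$ for all disjoint $x,y \in E$. $\mathcal{O}(E,F)$ is the vector space of all OAOs, ordered by $S \le T$ iff $S(x) \le T(x)$ for all $x \in E$; $T^- := (-T) \vee 0$ is the least upper bound of $-T$ and $0$ in this ordered vector space. $\mathcal{P}(E,F)$ is the set of laterally-to-order bounded OAOs, i.e. those $T$ for which $T(\mathfrak{F}_e)$ is order bounded in $F$ for every $e \in E$. $\mathcal{U}(E,F)$ is the set of order bounded OAOs (abstract Uryson operators), i.e. those sending order bounded subsets of $E$ to order bounded subsets of $F$. *)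

(* Defs.v *)
From HB Require Import structures.
From mathcomp Require Import all_boot all_order all_algebra.
From mathcomp Require Import boolp classical_sets functions reals.

Set Implicit Arguments.
Unset Strict Implicit.
Unset Printing Implicit Defensive.

Import Order.TTheory GRing.Theory Num.Theory.

Local Open Scope classical_set_scope.
Local Open Scope order_scope.
Local Open Scope ring_scope.

(* Riesz spaces (real vector lattices). The lattice operations are fields of
   the mixin because HB rejects a structure combining Order.Lattice with
   GRing.Zmodule that is declared after Num.RealDomain; the Order.Lattice
   structure is recovered just below. *)
HB.mixin Record POrderLmodule_isRiesz (K : realType) V
    of Order.POrder ring_display V & GRing.Lmodule K V := {
  rmeet : V -> V -> V;
  rjoin : V -> V -> V;
  rmeetP : forall x y z : V, (x <= rmeet y z) = (x <= y) && (x <= z);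
  rjoinP : forall x y z : V, (rjoin x y <= z) = (x <= z) && (y <= z);
  riesz_leD2r : forall z x y : V, x <= y -> x + z <= y + z;
  riesz_scale_ge0 : forall (a : K) (x : V), 0 <= a -> 0 <= x -> 0 <= a *: x
}.

#[short(type="rieszType")]
HB.structure Definition Riesz (K : realType) :=
  { V of Num.POrderedZmodule V & GRing.Lmodule K V & POrderLmodule_isRiesz K V }.

HB.instance Definition _ (K : realType) (V : rieszType K) :=
  Order.POrder_MeetJoin_isLattice.Build ring_display V (@rmeetP K V) (@rjoinP K V).

Section Disjointness.
Context {K : realType} {E : rieszType K}.
Implicit Types x y e : E.

Definition rabs x : E := (x `|` - x)%O.

Definition disjointv x y : Prop := (rabs x `&` rabs y)%O = 0.

Definition fragment x y : Prop := disjointv x (y - x).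

Definition fragments e : set E := [set x | fragment x e].

Definition order_bounded (A : set E) : Prop := has_lbound A /\ has_ubound A.

End Disjointness.

Section OrthogonallyAdditive.
Context {K : realType} {E F : rieszType K}.

Definition orthogonally_additive (T : E -> F) : Prop :=
  forall x y : E, disjointv x y -> T (x + y) = T x + T y.

Definition oao_pred : {pred E -> F} := fun T => `[< orthogonally_additive T >].

Lemma oao_submod_closed : submod_closed oao_pred.
Proof.
split; first by apply/asboolP => x y _; rewrite /= addr0.
move=> a S T /asboolP HS /asboolP HT; apply/asboolP => x y xy.
have E1 z : (a *: S + T) z = a *: S z + T z by [].
by rewrite !E1 HS // HT // scalerDr addrACA.
Qed.

HB.instance Definition _ :=
  GRing.isSubmodClosed.Build K (E -> F) oao_pred oao_submod_closed.

End OrthogonallyAdditive.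

(* The ordered vector space O(E, F), with the pointwise linear structure and
   the pointwise order inherited from E -> F. *)
Section OAOSpace.
Context {K : realType} (E F : rieszType K).

Record oao := Oao { oao_fun :> E -> F; oao_funP : oao_fun \in oao_pred }.

HB.instance Definition _ := [isSub for oao_fun].
HB.instance Definition _ := [Choice of oao by <:].
HB.instance Definition _ := [SubChoice_isSubLmodule of oao by <:].
HB.instance Definition _ :=
  [SubChoice_isSubPOrder of oao by <: with ring_display].

Lemma oaoP (T : oao) : orthogonally_additive T.
Proof. exact/asboolP/oao_funP. Qed.

Lemma oao_eqP (S T : oao) : S =1 T -> S = T.
Proof. by move=> ST; apply/val_inj/funext. Qed.

Lemma oao_leP (S T : oao) : reflect (forall x, S x <= T x) (S <= T).
Proof. exact: lefP. Qed.

Lemma oao0E x : (0 : oao) x = 0.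
Proof. by []. Qed.

Lemma oaoNE (T : oao) x : (- T) x = - T x.
Proof. by []. Qed.

Definition is_neg_part (T N : oao) : Prop := supremums [set - T; 0] N.

Definition lateral_to_order_bounded : set oao :=
  [set T | forall e : E, order_bounded (T @` fragments e)].

Definition uryson : set oao :=
  [set T | forall A : set E, order_bounded A -> order_bounded (T @` A)].

End OAOSpace.

Arguments is_neg_part {K E F}.
Arguments lateral_to_order_bounded {K E F}.
Arguments uryson {K E F}.

(* Main.v *)
Require Import Defs.
From HB Require Import structures.
From mathcomp Require Import all_boot all_order all_algebra.
From mathcomp Require Import boolp classical_sets functions reals.
Import Order.TTheory GRing.Theory Num.Theory.
Local Open Scope classical_set_scope.
Local Open Scope ring_scope.

(* If x and y are disjoint, u + v runs over the fragments of x + y as u and v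
   run over the fragments of x and y: a fragment w of x + y is the sum of the
   parts it shares with x and with y, which are obtained by taking the meets of
   the positive parts and of the negative parts separately. Since T is additive
   on such u + v, the infimum of T over the fragments of x + y is the sum of the
   infima over those of x and of y, so R is orthogonally additive. Any
   orthogonally additive S >= -T, 0 satisfies S x = S u + S (x - u) >= - T u for
   every fragment u of x, hence S >= R. The two boundedness claims hold because
   the fragments of a fragment of e are fragments of e, and a fragment u of x
   satisfies |u| <= |x|. *)

Section RieszSpace.
Set Implicit Arguments.
Unset Strict Implicit.
Context {K : realType} {V : rieszType K}.
Implicit Types a b c x y z p n u v w : V.

(** * Order arithmetic and lattice identities *)

Lemma riesz_leD2rE z x y : (x + z <= y + z) = (x <= y).
Proof.
apply/idP/idP; last exact: riesz_leD2r.
by move=> /(riesz_leD2r (- z) _ _); rewrite !addrK.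
Qed.

Lemma riesz_leD x y z u : x <= y -> z <= u -> x + z <= y + u.
Proof.
move=> xy zu; apply: (le_trans (riesz_leD2r z _ _ xy)).
by rewrite ![y + _]addrC riesz_leD2rE.
Qed.

Lemma riesz_addr_ge0 x y : 0 <= x -> 0 <= y -> 0 <= x + y.
Proof. by move=> x0 y0; rewrite -[0]addr0 riesz_leD. Qed.

Lemma riesz_leDl x y : 0 <= y -> x <= x + y.
Proof. by move=> y0; rewrite -[leLHS]addr0 riesz_leD. Qed.

Lemma riesz_leDr x y : 0 <= y -> x <= y + x.
Proof. by move=> y0; rewrite addrC riesz_leDl. Qed.

Lemma riesz_leBrDr x y z : (x <= y - z) = (x + z <= y).
Proof. by rewrite -(riesz_leD2rE z) subrK. Qed.

Lemma riesz_leBlDr x y z : (x - z <= y) = (x <= y + z).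
Proof. by rewrite -(riesz_leD2rE z (x - z)) subrK. Qed.

Lemma riesz_leN2 x y : (- x <= - y) = (y <= x).
Proof. by rewrite -(riesz_leD2rE (x + y) (- x)) addKr [x + y]addrC addKr. Qed.

Lemma riesz_leNr x y : (x <= - y) = (y <= - x).
Proof. by rewrite -{1}[x]opprK riesz_leN2. Qed.

Lemma riesz_leNl x y : (- x <= y) = (- y <= x).
Proof. by rewrite -{1}[y]opprK riesz_leN2. Qed.

Lemma riesz_meetDl x y z : (x `&` y)%O + z = ((x + z) `&` (y + z))%O.
Proof.
apply/le_anti; rewrite lexI !riesz_leD2rE leIl leIr /=.
by rewrite -riesz_leBlDr lexI !riesz_leBlDr leIl leIr.
Qed.

Lemma riesz_joinDl x y z : (x `|` y)%O + z = ((x + z) `|` (y + z))%O.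
Proof.
apply/le_anti; rewrite [X in _ && X]leUx !riesz_leD2rE leUl leUr !andbT.
by rewrite -riesz_leBrDr leUx !riesz_leBrDr leUl leUr.
Qed.

Lemma riesz_oppI x y : - (x `&` y)%O = (- x `|` - y)%O.
Proof.
apply/le_anti; rewrite [X in _ && X]leUx !riesz_leN2 leIl leIr !andbT.
by rewrite riesz_leNl lexI ![_ <= x]riesz_leNl ![_ <= y]riesz_leNl leUl leUr.
Qed.

Lemma riesz_joinDmeet x y : (x `|` y)%O + (x `&` y)%O = x + y.
Proof.
apply: (addIr (- (x `&` y)%O)); rewrite addrK riesz_oppI addrC riesz_joinDl.
by rewrite addKr [x + y]addrC addKr joinC.
Qed.

(** Translation invariance expands the right side into the meet of [a + a], [c + a], [a + b] and
    [c + b]; each of these dominates [a] or [b + c]. *)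
Lemma riesz_meetD_le a b c : 0 <= a -> 0 <= b -> 0 <= c ->
  (a `&` (b + c) <= (a `&` b) + (a `&` c))%O.
Proof.
move=> a0 b0 c0; rewrite riesz_meetDl ![_ + (a `&` c)%O]addrC !riesz_meetDl.
rewrite !lexI [c + b]addrC leIr andbT.
by rewrite !(le_trans (leIl _ _)) // ?riesz_leDl ?riesz_leDr.
Qed.

Lemma riesz_meet_eq0_le a b x y : 0 <= a -> 0 <= b -> a <= x -> b <= y ->
  (x `&` y)%O = 0 -> (a `&` b)%O = 0.
Proof.
move=> a0 b0 ax bY xy; by apply/le_anti; rewrite lexI a0 b0 -xy leI2.
Qed.

Lemma riesz_meetD_eq0 a b c : 0 <= a -> 0 <= b -> 0 <= c ->
  (a `&` b)%O = 0 -> (a `&` c)%O = 0 -> (a `&` (b + c))%O = 0.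
Proof.
move=> a0 b0 c0 ab ac; apply/le_anti; rewrite lexI a0 riesz_addr_ge0 // !andbT.
by rewrite (le_trans (riesz_meetD_le _ _ _)) // ab ac addr0.
Qed.

(** The meets [a] with [b] and [a] with [c] are themselves disjoint, so their sum is their join,
    which lies below both [a] and [b + c]. *)
Lemma riesz_meet_disjD a b c : 0 <= a -> 0 <= b -> 0 <= c -> (b `&` c)%O = 0 ->
  (a `&` (b + c))%O = (a `&` b)%O + (a `&` c)%O.
Proof.
move=> a0 b0 c0 bc; apply/le_anti; rewrite riesz_meetD_le //=.
have abc : ((a `&` b) `&` (a `&` c))%O = 0.
  by apply: riesz_meet_eq0_le bc; rewrite ?leIr // lexI a0.
rewrite -riesz_joinDmeet abc addr0 leUx !lexI !leIl /=.
by rewrite !(le_trans (leIr _ _)) ?riesz_leDl ?riesz_leDr.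
Qed.

(** * Positive parts and absolute values *)

Lemma rabs_ge0 x : 0 <= rabs x.
Proof.
(* Twice [rabs x] dominates [x + (- x) = 0], and scaling by one half preserves positivity. *)
suff: 0 <= 2%:R *: rabs x.
  move=> /(riesz_scale_ge0 (2%:R^-1 : K)); rewrite invr_ge0 ler0n => /(_ isT).
  by rewrite scalerA mulVf ?scale1r // pnatr_eq0.
by rewrite scaler_nat mulr2n -(subrr x) riesz_leD // ?leUl ?leUr.
Qed.

Definition pospart x : V := (x `|` 0)%O.

Lemma pospart_ge0 x : 0 <= pospart x.
Proof. exact: leUr. Qed.

Lemma pospart_sub x : pospart x - pospart (- x) = x.
Proof.
apply/eqP; rewrite subr_eq; apply/eqP.
by rewrite /pospart addrC riesz_joinDl addNr add0r joinC.
Qed.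

Lemma pospart_meet x : (pospart x `&` pospart (- x))%O = 0.
Proof.
have -> : pospart x = x + pospart (- x) by rewrite -{2}(pospart_sub x) subrK.
rewrite -[X in (_ `&` X)%O]add0r -riesz_meetDl.
have -> : pospart (- x) = - (x `&` 0)%O by rewrite riesz_oppI oppr0.
exact: subrr.
Qed.

Lemma rabsE x : rabs x = pospart x + pospart (- x).
Proof.
rewrite -riesz_joinDmeet pospart_meet addr0 /pospart joinACA joinxx.
by apply/esym/join_idPl/rabs_ge0.
Qed.

Lemma rabsN x : rabs (- x) = rabs x.
Proof. by rewrite /rabs opprK joinC. Qed.

Lemma pospart_le_rabs x : pospart x <= rabs x.
Proof. by rewrite rabsE riesz_leDl ?pospart_ge0. Qed.

(** Uniqueness of the decomposition into disjoint positive and negative parts: adding [n] to the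
    join of [p - n] and [0] gives the join of [p] and [n], which is [p + n]. *)
Lemma pospart_subE p n : (p `&` n)%O = 0 -> pospart (p - n) = p.
Proof.
move=> pn; rewrite /pospart -(subrr n) -riesz_joinDl.
by apply/eqP; rewrite subr_eq -riesz_joinDmeet pn addr0.
Qed.

Lemma rabs_subE p n : (p `&` n)%O = 0 -> rabs (p - n) = p + n.
Proof.
by move=> pn; rewrite rabsE opprB !pospart_subE // meetC.
Qed.

Lemma rabsD_le x y : rabs (x + y) <= rabs x + rabs y.
Proof. by rewrite leUx opprD !riesz_leD // ?leUl ?leUr. Qed.

(** * Disjointness and additivity on disjoint sums *)

Lemma disjointvC x y : disjointv x y -> disjointv y x.
Proof. by rewrite /disjointv meetC. Qed.

Lemma disjointv_le a b x y :
  rabs a <= rabs x -> rabs b <= rabs y -> disjointv x y -> disjointv a b.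
Proof. by apply: riesz_meet_eq0_le; exact: rabs_ge0. Qed.

Lemma disjointvNN x y : disjointv x y -> disjointv (- x) (- y).
Proof. by rewrite /disjointv !rabsN. Qed.

Lemma disjointvDr x y z : disjointv x y -> disjointv x z -> disjointv x (y + z).
Proof.
move=> xy xz; have := riesz_meetD_eq0 (rabs_ge0 x) (rabs_ge0 y)
  (rabs_ge0 z) xy xz.
apply: riesz_meet_eq0_le; rewrite ?rabs_ge0 //; exact: rabsD_le.
Qed.

Lemma disjointv0 x : disjointv 0 x.
Proof.
apply/le_anti; rewrite lexI !rabs_ge0 !andbT.
by rewrite (le_trans (leIl _ _)) // /rabs oppr0 joinxx.
Qed.

Lemma disjointv_pospart x y : disjointv x y -> (pospart x `&` pospart y)%O = 0.
Proof.
by apply: riesz_meet_eq0_le; rewrite ?pospart_ge0 ?pospart_le_rabs.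
Qed.

Lemma pospartD x y : disjointv x y -> pospart (x + y) = pospart x + pospart y.
Proof.
move=> xy; rewrite -{1}(pospart_sub x) -{1}(pospart_sub y) addrACA -opprD.
(* Disjointness sees only absolute values, so the mixed meets vanish for every choice of signs of
   [x] and [y]. *)
have H a b : rabs a = rabs x -> rabs b = rabs y ->
    (pospart a `&` pospart b)%O = 0.
  by move=> ax bY; apply: disjointv_pospart; rewrite /disjointv ax bY.
apply: pospart_subE; rewrite meetC.
apply: riesz_meetD_eq0; rewrite ?riesz_addr_ge0 ?pospart_ge0 //.
- rewrite meetC; apply: riesz_meetD_eq0; rewrite ?pospart_ge0 ?pospart_meet //.
  by rewrite H ?rabsN.
- rewrite meetC; apply: riesz_meetD_eq0; rewrite ?pospart_ge0 ?pospart_meet //.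
  by rewrite meetC H ?rabsN.
Qed.

Lemma rabsD x y : disjointv x y -> rabs (x + y) = rabs x + rabs y.
Proof.
move=> xy; rewrite !rabsE opprD pospartD // (pospartD (disjointvNN xy)).
exact: addrACA.
Qed.

(** * Common refinement of two disjoint decompositions *)

Definition shared_part x y : V :=
  (pospart x `&` pospart y)%O - (pospart (- x) `&` pospart (- y))%O.

Lemma shared_partC x y : shared_part x y = shared_part y x.
Proof. by rewrite /shared_part meetC [X in _ - X]meetC. Qed.

Lemma rabs_shared_part x y : rabs (shared_part x y) <= rabs x.
Proof.
rewrite rabs_subE ?rabsE; first by rewrite riesz_leD ?leIl.
by apply: riesz_meet_eq0_le (pospart_meet x);
  rewrite ?leIl // lexI !pospart_ge0.
Qed.

(** The positive part of [w] lies below that of [w + v], which is the disjoint sum of those of [x]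
    and [y], so meeting with it distributes; negating everything handles the negative parts. The two
    decompositions play symmetric roles, so any of the four terms can be split. *)
Lemma shared_part_split w v x y : disjointv w v -> disjointv x y ->
  w + v = x + y -> w = shared_part w x + shared_part w y.
Proof.
move=> wv xy e.
have pos_split a b c d : disjointv a b -> disjointv c d -> a + b = c + d ->
    pospart a = (pospart a `&` pospart c)%O + (pospart a `&` pospart d)%O.
  move=> ab cd e'; rewrite -riesz_meet_disjD ?pospart_ge0 //; last first.
    exact: disjointv_pospart.
  rewrite -pospartD // -e' pospartD //; apply/esym/meet_idPl.
  by rewrite riesz_leDl ?pospart_ge0.
rewrite addrACA -opprD -(pos_split _ _ _ _ wv xy e).
rewrite -(pos_split _ (- v)) ?pospart_sub -?opprD ?e //; exact: disjointvNN.
Qed.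

(** * Fragments *)

Lemma fragment0 x : fragment 0 x.
Proof. exact: disjointv0. Qed.

Lemma fragmentxx x : fragment x x.
Proof. by rewrite /fragment subrr; exact/disjointvC/disjointv0. Qed.

Lemma rabs_fragment u x : fragment u x -> rabs u <= rabs x.
Proof.
by move=> /rabsD; rewrite addrC subrK => ->; rewrite riesz_leDl ?rabs_ge0.
Qed.

Lemma fragmentC u x : fragment u x -> fragment (x - u) x.
Proof. by move=> /disjointvC; rewrite /fragment subKr. Qed.

(** Both summands of [e - u = (x - u) + (e - x)] are disjoint from [u], the second because
    [rabs u <= rabs x]. *)
Lemma fragment_trans u x e : fragment u x -> fragment x e -> fragment u e.
Proof.
move=> ux xe; rewrite /fragment.
have -> : e - u = x - u + (e - x) by rewrite [RHS]addrC addrA subrK.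
apply: disjointvDr => //.
by apply: disjointv_le xe => //; exact: rabs_fragment.
Qed.

Lemma disjointv_fragments u x v y : disjointv x y -> fragment u x ->
  fragment v y -> disjointv u v.
Proof.
by move=> xy ux vy; apply: disjointv_le xy; exact: rabs_fragment.
Qed.

Lemma fragmentD u x v y : disjointv x y -> fragment u x -> fragment v y ->
  fragment (u + v) (x + y).
Proof.
move=> xy ux vy; rewrite /fragment opprD addrACA.
have ux' := fragmentC ux; have vy' := fragmentC vy.
apply/disjointvC/disjointvDr; apply/disjointvC/disjointvDr => //.
- exact: (disjointv_fragments xy ux vy').
- by apply: disjointvC; exact: (disjointv_fragments xy ux' vy).
Qed.

Lemma fragment_addP w x y : disjointv x y -> fragment w (x + y) ->
  exists u v, [/\ fragment u x, fragment v y & w = u + v].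
Proof.
set v := x + y - w => xy wv.
have e : w + v = x + y by rewrite addrC subrK.
(* The complement in [z] of its part shared with [w] is its part shared with [v], so the two inherit
   disjointness from [w] and [v]. *)
have shared_fragment z : z = shared_part w z + shared_part v z ->
    fragment (shared_part w z) z.
  move=> {2}->; rewrite /fragment [X in X - _]addrC addrK.
  by apply: disjointv_le wv; exact: rabs_shared_part.
exists (shared_part w x), (shared_part w y); split.
- apply: shared_fragment; rewrite ![shared_part _ x]shared_partC.
  exact: shared_part_split xy wv (esym e).
- apply: shared_fragment; rewrite ![shared_part _ y]shared_partC.
  by apply: shared_part_split (disjointvC xy) wv _; rewrite addrC.
- exact: shared_part_split wv xy e.
Qed.

Lemma rabs_le_itv a b x : a <= x -> x <= b -> rabs x <= (rabs a `|` rabs b)%O.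
Proof.
move=> ax xb; rewrite leUx; apply/andP; split.
  by rewrite (le_trans xb) // (le_trans _ (leUr _ _)) // leUl.
by rewrite (le_trans _ (leUl _ _)) // (le_trans _ (leUr _ _)) // riesz_leN2.
Qed.

End RieszSpace.

Theorem corollary3p5 (K : realType) (E F : rieszType K) (T : oao E F)
    (R : E -> F)
    (HR : forall x : E, infimums (T @` fragments x) (- R x)) :
  exists Tneg : oao E F,
    [/\ is_neg_part T Tneg,
        forall x : E, Tneg x = R x,
        lateral_to_order_bounded T -> lateral_to_order_bounded Tneg
      & uryson T -> uryson Tneg].
Proof.
have T0 : T 0 = 0.
  by have /(addIr _)/esym : 0 + T 0 = T 0 + T 0
    by rewrite -oaoP ?addr0 ?add0r //; exact: disjointv0.
have R_inf x u : fragment u x -> - R x <= T u.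
  by move=> ux; have [+ _] := HR x; apply; exists u.
have R_glb x m : (forall u, fragment u x -> m <= T u) -> m <= - R x.
  by move=> mT; have [_ +] := HR x; apply => _ [u ux <-]; exact: mT.
have R0 x : 0 <= R x.
  by rewrite -riesz_leN2 oppr0 -T0; exact/R_inf/fragment0.
have RD : orthogonally_additive R.
  move=> x y xy; apply: oppr_inj; apply/le_anti/andP; split; rewrite opprD.
    (* All other terms move to the left, so that one infimum at a time stands alone and is replaced
       by an arbitrary value [T u], then [T v]. *)
    rewrite -riesz_leBlDr; apply: (R_glb) => u ux.
    rewrite riesz_leBlDr [T u + _]addrC -riesz_leBlDr; apply: R_glb => v vy.
    rewrite riesz_leBlDr [T v + _]addrC.
    rewrite -oaoP; last exact: (disjointv_fragments xy ux vy).
    exact/R_inf/fragmentD.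
  apply: R_glb => w /(fragment_addP xy) [u [v [ux vy ->]]].
  rewrite oaoP; last exact: (disjointv_fragments xy ux vy).
  by apply: riesz_leD; exact: R_inf.
have RP : R \in oao_pred by exact/asboolP.
exists (Oao RP); split => //.
- split.
    move=> S [->|->]; apply/oao_leP => x; last exact: R0.
    by rewrite oaoNE riesz_leNl; exact/R_inf/fragmentxx.
  move=> S S_ub.
  have /oao_leP TS : - T <= S by apply: S_ub; left.
  have /oao_leP S0 : 0 <= S by apply: S_ub; right.
  apply/oao_leP => x /=; rewrite -riesz_leN2; apply: (R_glb) => u ux.
  rewrite riesz_leNl (le_trans (TS u)) //.
  rewrite -[in leRHS](subrK u x) addrC oaoP //; apply: riesz_leDl; exact: S0.
- move=> T_bd e; have [[m Tm] _] := T_bd e; split.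
    by exists 0 => _ [x _ <-] /=; exact: R0.
  (* A lower bound [m] of [T] on the fragments of [e] also bounds [T] on the fragments of each
     fragment [x], so [m <= - R x]. *)
  exists (- m) => _ [x xe <-] /=; rewrite riesz_leNr.
  apply: R_glb => u ux; apply: Tm; exists u => //=.
  exact: fragment_trans xe.
- move=> T_bd A [[a aA] [b Ab]]; split.
    by exists 0 => _ [x _ <-] /=; exact: R0.
  (* [c] dominates [rabs x] for every [x] in [A], so the interval from [- c] to [c] contains all
     fragments of elements of [A]. *)
  set c := (rabs a `|` rabs b)%O.
  have [|[m Tm] _] := T_bd [set x | - c <= x /\ x <= c].
    by split; [exists (- c) => x [] | exists c => x []].
  exists (- m) => _ [x Ax <-] /=; rewrite riesz_leNr.
  apply: R_glb => u ux; apply: Tm; exists u => //=.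
  have uc : rabs u <= c.
    apply: le_trans (rabs_fragment ux) _.
    by apply: rabs_le_itv; [exact: aA | exact: Ab].
  by rewrite riesz_leNl; split; apply: le_trans uc; rewrite ?leUl ?leUr.
Qed.
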